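(* Let $m\in\mathfrak m_{\mathsf I}$. Then for every translucent word $t$ and every incomplete word $w\in\mathcal W(t)$, $$\exp_\star(m)(w)=\sum_{(\pi,\lambda)\in\mathcal M(t)}\frac1{|\pi|!}\prod_{V\in\pi}m(w|_V),$$ where $\mathcal M(t)$ is the set of monotone bipartitions of type $t$.
   Context: Write $\llbracket n\rrbracket=\{1,\dots,n\}$; $A\subset B$ allows equality. For a word $w$ of length $|w|$ and $A=\{i_1<\dots<i_p\}\subset\llbracket|w|\rrbracket$, $w|_A=w(i_1)\cdots w(i_p)$. Translucent words. A translucent word is a pair $t=(\alpha_t,b_t)$ of words of equal length $|t|\ge0$, $\alpha_t\in\{\mathsf L,\mathsf R\}^\star$, $b_t\in\{0,1\}^\star$. Put $[t]_0=\{i:b_t(i)=0\}$, $[t]_1=\{i:b_t(i)=1\}$, $t(i)=(\alpha_t(i),b_t(i))$. The necklace order $\lessdot$ on $\llbracket|t|\rrbracket$ is the total order in which all $\mathsf L$-positions precede all $\mathsf R$-positions, the $\mathsf L$-positions being ordered increasingly and the $\mathsf R$-positions decreasingly. $\mathrm{int}(t)$ is the set of maximal (nonempty) intervals of $(\llbracket|t|\rrbracket,\lessdot)$ contained in $[t]_1$. Incomplete words. Fix finite sets $\dot S^{\mathsf L},\dot S^{\mathsf R}$ of left and right random variables (finite subsets of two subalgebras of a unital complex algebra, treated as disjoint and disjoint from the placeholder symbols $\mathsf L,\mathsf R$). Put $S^{(\mathsf L,0)}=\{\mathsf L\}$, $S^{(\mathsf R,0)}=\{\mathsf R\}$, $S^{(\mathsf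 L,1)}=\dot S^{\mathsf L}$, $S^{(\mathsf R,1)}=\dot S^{\mathsf R}$, and $\mathcal W(t)=S^{t(1)}\times\cdots\times S^{t(|t|)}$; elements are incomplete words of type $t$. For $w\in\mathcal W(t)$ put $[w]_i=[t]_i$, $\mathrm{int}(w)=\mathrm{int}(t)$; the translucidation $w_{I\leadsto0}$ ($I\subset\llbracket|w|\rrbracket$) is obtained by replacing $w(j)$ by the placeholder $\alpha_t(j)$ for every $j\in I$. A linear form on $\mathbb C\mathcal W$ is a linear functional on $\bigoplus_t\mathbb C\mathcal W(t)$, i.e. is given by arbitrary values on incomplete words. Convolution and exponential. $\varepsilon(w)=1$ if $w\in\{\mathsf L,\mathsf R\}^\star$ (only placeholders), $\varepsilon(w)=0$ otherwise. For linear forms $f,g$, $$(f\star g)(w)=\sum_{[w]_0\subset I\subset\llbracket|w|\rrbracket}f(w|_I)\,g(w_{I\leadsto0}).$$ For $m$ vanishing on $\{\mathsf L,\mathsf R\}^\star$, $\exp_\star(m)=\varepsilon+\sum_{n\ge1}\frac1{n!}m^{\star n}$ (a finite sum when evaluated on a word). $\mathfrak m_{\mathsf I}$ is the set of linear forms $f$ on $\mathbb C\mathcal W$ such that $f(w)=0$ whenever $|\mathrm{int}(w)|\ne1$, and $f(w)=f(w|_{[w]_1})$ whenever $|\mathrm{int}(w)|=1$. Partitions. A monotone bipartition of type $t$ is a pair $(\pi,\lambda)$ where $\pi$ is a set partition of $[t]_1$ and $\lambda:\pi\to\llbracket|\pi|\rrbracket$ is a bijection (a total order on the blocks) such that, after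 adding $[t]_0$ (if nonempty) as a block with label $0$ (the minimum block), the resulting ordered partition of $(\llbracket|t|\rrbracket,\lessdot)$ is monotone: it is noncrossing (no $a\lessdot b\lessdot c\lessdot d$ with $a,c$ in one block and $b,d$ in another) and whenever $a\lessdot b\lessdot c$ with $a,c$ in a block $V$ and $b$ in a block $V'$, the label of $V$ is at most the label of $V'$. *)

(* Defs.v *)
From HB Require Import structures.
From mathcomp Require Import all_boot all_order all_algebra.
From mathcomp Require Import boolp classical_sets fsbigop reals.
From mathcomp Require Import complex.

Set Implicit Arguments.
Unset Strict Implicit.
Unset Printing Implicit Defensive.

Import GRing.Theory.
Local Open Scope ring_scope.

Variant side := sideL | sideR.

Definition is_left (s : side) : bool := if s is sideL then true else false.
Definition side_of_bool (b : bool) : side := if b then sideL else sideR.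
Lemma is_leftK : cancel is_left side_of_bool. Proof. by case. Qed.
HB.instance Definition _ := Equality.copy side (can_type is_leftK).

(* A translucent word of length n is an element of n.-tuple (side * bool): the
   pair of words (alpha_t, b_t) is stored zipped, with b_t valued in
   {false = 0, true = 1}.  Positions are 'I_n, i.e. numbered from 0. *)

Definition zeros n (t : n.-tuple (side * bool)) : {set 'I_n} :=
  [set i | ~~ (tnth t i).2].

Definition ones n (t : n.-tuple (side * bool)) : {set 'I_n} :=
  [set i | (tnth t i).2].

Definition necklace_lt n (t : n.-tuple (side * bool)) (i j : 'I_n) : bool :=
  match (tnth t i).1, (tnth t j).1 with
  | sideL, sideL => (i < j)%N
  | sideL, sideR => true
  | sideR, sideL => false
  | sideR, sideR => (j < i)%N
  end.

Definition necklace_interval n (t : n.-tuple (side * bool)) (U : {set 'I_n}) :=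
  [forall a in U, forall c in U, forall b,
     necklace_lt t a b && necklace_lt t b c ==> (b \in U)].

Definition necklace_int n (t : n.-tuple (side * bool)) : {set {set 'I_n}} :=
  [set U | maxset (fun V => [&& V != finset.set0, necklace_interval t V
                              & V \subset ones t]) U].

(* SL and SR are the finite sets of left and right random variables.  The
   constructors make the two alphabets disjoint from each other and from the
   placeholders. *)
Variant letter (SL SR : Type) :=
  Placeholder of side | LeftVar of SL | RightVar of SR.
Arguments Placeholder {SL SR}.
Arguments LeftVar {SL SR}.
Arguments RightVar {SL SR}.

Definition letter_type SL SR (l : letter SL SR) : side * bool :=
  match l with
  | Placeholder s => (s, false)
  | LeftVar _ => (sideL, true)
  | RightVar _ => (sideR, true)
  end.

Definition alphabet SL SR (a : side * bool) : pred (letter SL SR) :=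
  [pred l | letter_type l == a].

Definition words SL SR n (t : n.-tuple (side * bool)) :
    pred (n.-tuple (letter SL SR)) :=
  [pred w | [forall i, tnth w i \in alphabet (tnth t i)]].

(* The alphabets of distinct types are disjoint, so every sequence of letters
   is an incomplete word of exactly one type. *)
Definition word_type SL SR n (w : n.-tuple (letter SL SR)) :
    n.-tuple (side * bool) :=
  [tuple of map (@letter_type SL SR) w].

(* enum A lists A increasingly, so this is w(i_1) ... w(i_p). *)
Definition restr SL SR n (w : n.-tuple (letter SL SR)) (A : {set 'I_n}) :
    seq (letter SL SR) :=
  [seq tnth w i | i <- enum A].

Definition translucidation SL SR n (w : n.-tuple (letter SL SR))
    (I : {set 'I_n}) : n.-tuple (letter SL SR) :=
  [tuple if i \in I then Placeholder (letter_type (tnth w i)).1 else tnth w i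
  | i < n].

(* A linear form on the span of the incomplete words, given by its values on
   the basis of words. *)
Definition linear_form (R : realType) (SL SR : Type) :=
  seq (letter SL SR) -> R[i].

Definition counit (R : realType) SL SR : linear_form R SL SR :=
  fun w => if all (fun l => ~~ (letter_type l).2) w then 1 else 0.

Definition conv (R : realType) SL SR (f g : linear_form R SL SR) :
    linear_form R SL SR :=
  fun w => let w' := in_tuple w in
    \sum_(I : {set 'I_(size w)} | zeros (word_type w') \subset I)
       f (restr w' I) * g (translucidation w' I).

Definition conv_pow (R : realType) SL SR (m : linear_form R SL SR) (n : nat) :
    linear_form R SL SR :=
  iterop n (@conv R SL SR) m (@counit R SL SR).

(* The sum is the finite-support sum of fsbigop: when m vanishes on words of
   placeholders, only finitely many terms are nonzero on a given word. *)
Definition conv_exp (R : realType) SL SR (m : linear_form R SL SR) :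
    linear_form R SL SR :=
  fun w => counit R w +
    \sum_(n \in [set n : nat | (1 <= n)%N]%classic)
       (n`!%:R)^-1 * conv_pow m n w.

Definition in_mI (R : realType) SL SR (f : linear_form R SL SR) : Prop :=
  forall n (w : n.-tuple (letter SL SR)),
    (#|necklace_int (word_type w)| <> 1%N -> f w = 0) /\
    (#|necklace_int (word_type w)| = 1%N -> f w = f (restr w (ones (word_type w)))).

Definition noncrossing (T : finType) (lt : rel T) (P : {set {set T}}) : bool :=
  [forall V in P, forall V' in P, (V != V') ==>
     [forall a in V, forall b in V', forall c in V, forall d in V',
        ~~ [&& lt a b, lt b c & lt c d]]].

Definition monotone_partition (T : finType) (lt : rel T) (P : {set {set T}})
    (label : {set T} -> nat) : bool :=
  noncrossing lt P &&
  [forall V in P, forall V' in P,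
     [forall a in V, forall b in V', forall c in V,
        lt a b && lt b c ==> (label V <= label V')%N]].

(* Pairs (P, lambda); the label k of the text is represented by k - 1. *)
Definition labelled_blocks n :=
  {P : {set {set 'I_n}} & {ffun {V : {set 'I_n} | V \in P} -> 'I_#|P|}}.

Definition extended_blocks n (t : n.-tuple (side * bool))
    (p : labelled_blocks n) : {set {set 'I_n}} :=
  if zeros t == finset.set0 then tag p else zeros t |: tag p.

(* Restores the labels 1, ..., #|P| on the blocks of P; the added block of
   zeros, which is not in P, gets label 0. *)
Definition extended_label n (p : labelled_blocks n) (V : {set 'I_n}) : nat :=
  if insub V is Some V' then (tagged p V').+1 else 0%N.

Definition monotone_bipartitions n (t : n.-tuple (side * bool)) :
    {set labelled_blocks n} :=
  [set p : labelled_blocks n | [&& finset.partition (tag p) (ones t),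
               injectiveb (tagged p),
               [forall k, k \in codom (tagged p)]
             & monotone_partition (necklace_lt t) (extended_blocks t p)
                 (extended_label p)]].

(* Main.v *)
Require Import Defs.
From mathcomp Require Import all_boot all_order all_algebra.
From mathcomp Require Import reals complex.
From mathcomp Require classical_sets fsbigop.

(** Unfolding the convolution power [m^k(w)] peels off one block at a time:
    it is a sum over chains [Z = I_0 <= I_1 <= ... <= I_k] of sets of positions,
    where [Z] is the set of zeros of [w] and [I_k] is everything, of the products
    of the values of [m] at the words of [w_(I_(j-1) ~> 0)] restricted to [I_j].
    Put [V_j = I_j - I_(j-1)]. Since [m] lives on the words whose positions
    coloured 1 form exactly one necklace interval, and then only sees these
    positions, the [j]-th factor is [m (w|_(V_j))] if [V_j] is nonempty and
    contains no element of [I_(j-1)] between two of its own elements, and is 0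
    otherwise ([in_mI_restr]). As [I_(j-1)] is the union of [Z] and of the
    earlier blocks, these conditions say that no block surrounds an element of
    [Z] or of an earlier block ([monotone_seq], [conv_pow_translucidation]).

    This is the monotonicity of the labels of the ordered partition
    [(V_1, ..., V_k)], with [Z] as the minimum block. Monotonicity forbids
    crossings by itself: two crossing blocks each surround an element of the
    other, hence have equal labels. So the sequences of [k] blocks correspond
    bijectively to the monotone bipartitions with [k] blocks
    ([labelling_monotone_bipartition], [labelling_inj], [labelling_surj]), and
    the sum over [k] of [m^k(w) / k!] is the sum over all monotone bipartitions.
    The term [k = 0] is the counit, matched by the empty partition. *)

Local Open Scope ring_scope.

Section ConvolutionExponential.
Set Implicit Arguments.
Unset Strict Implicit.
Unset Printing Implicit Defensive.
Import GRing.Theory.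

(** * The necklace order *)

Lemma necklace_lt_asym n (t : n.-tuple (side * bool)) (a b : 'I_n) :
  necklace_lt t a b -> ~~ necklace_lt t b a.
Proof.
by rewrite /necklace_lt; case: (tnth t a).1; case: (tnth t b).1 => //;
   rewrite -leqNgt => /ltnW.
Qed.

(** Having exactly one maximal interval means that all the positions coloured 1
    form a single nonempty interval: each of them lies in some maximal one. *)
Lemma card_necklace_int n (t : n.-tuple (side * bool)) :
  (#|necklace_int t| == 1%N) =
  (ones t != set0) && necklace_interval t (ones t).
Proof.
apply/cards1P/andP => [[U defU]|[nz_t int_t]]; last first.
  exists (ones t); apply/setP=> U; rewrite !inE; apply/idP/eqP => [maxU|->].
    have /and3P[_ _ sU] := maxsetp maxU.
    by rewrite (maxsetsup maxU _ sU) // nz_t int_t subxx.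
  apply/maxsetP; rewrite nz_t int_t subxx; split=> // B /and3P[_ _ sB] sB'.
  by apply/eqP; rewrite eqEsubset sB sB'.
have: U \in necklace_int t by rewrite defU set11.
rewrite inE => /maxsetp/and3P[/set0Pn[x Ux] intU sU].
suff -> : ones t = U by split=> //; apply/set0Pn; exists x.
apply/eqP; rewrite eqEsubset sU andbT; apply/subsetP=> y t1y.
(* an element coloured 1 is an interval by itself *)
have: [&& [set y] != set0, necklace_interval t [set y]
        & [set y] \subset ones t].
  rewrite sub1set t1y andbT; apply/andP; split.
    by apply/set0Pn; exists y; rewrite set11.
  apply/forall_inP=> a /set1P->; apply/forall_inP=> c /set1P->.
  by apply/forallP=> b; apply/implyP=> /andP[/necklace_lt_asym/negbTE->].
case/(@maxset_exists _ [pred V | [&& V != set0, necklace_interval t V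
                                   & V \subset ones t]]).
move=> V maxV; have: V \in necklace_int t by rewrite inE.
by rewrite defU => /set1P->; rewrite sub1set.
Qed.

(** No element of [U] lies, in the order [lt], between two elements of [V]. *)
Definition never_inside (T : finType) (lt : rel T) (U V : {set T}) : bool :=
  [forall a in V, forall c in V, forall b in U, ~~ (lt a b && lt b c)].

Lemma never_insideP (T : finType) (lt : rel T) (U V : {set T}) :
  reflect (forall a b c, a \in V -> c \in V -> b \in U ->
             lt a b -> lt b c -> False)
          (never_inside lt U V).
Proof.
apply: (iffP idP) => [/forall_inP h a b c Va Vc Ub ab bc|h].
  by move/forall_inP: (h _ Va) => /(_ _ Vc)/forall_inP/(_ _ Ub); rewrite ab bc.
apply/forall_inP=> a Va; apply/forall_inP=> c Vc; apply/forall_inP=> b Ub.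
by apply/negP=> /andP[]; apply: h Va Vc Ub.
Qed.

Lemma never_insideUl (T : finType) (lt : rel T) (U U' V : {set T}) :
  never_inside lt (U :|: U') V = never_inside lt U V && never_inside lt U' V.
Proof.
apply/never_insideP/andP => [h|[/never_insideP h /never_insideP h'] a b c Va Vc].
  by split; apply/never_insideP=> a b c Va Vc Ub; apply: h Va Vc _;
     rewrite inE Ub ?orbT.
by case/setUP=> Ub; [apply: h Va Vc Ub | apply: h' Va Vc Ub].
Qed.

Lemma necklace_interval_ones n (t : n.-tuple (side * bool)) :
  necklace_interval t (ones t) = never_inside (necklace_lt t) (zeros t) (ones t).
Proof.
apply/idP/never_insideP=> [/forall_inP h a b c Va Vc|h].
  rewrite inE => /negP nb ab bc; apply: nb.
  move/forall_inP: (h _ Va) => /(_ _ Vc)/forallP/(_ b).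
  by rewrite ab bc inE.
apply/forall_inP=> a Va; apply/forall_inP=> c Vc; apply/forallP=> b.
apply/implyP=> /andP[ab bc]; apply: contraT => nb.
by case: (h a b c Va Vc) => //; move: nb; rewrite !inE.
Qed.

(** * Subwords *)

(** The enumeration of a set of positions is increasing, so that passing to a
    subword preserves the order of the positions. *)
Lemma enum_ord_sorted n (A : {pred 'I_n}) :
  sorted (fun i j : 'I_n => (i < j)%N) (enum A).
Proof.
rewrite {1}/enum_mem sorted_filter //; first by move=> j i k; apply: ltn_trans.
have := iota_ltn_sorted 0 n; rewrite -val_enum_ord sorted_map.
by rewrite enumT.
Qed.

Lemma enum_val_ord_mono n (A : {set 'I_n}) (i j : 'I_#|A|) :
  (enum_val i < enum_val j)%N = (i < j)%N.
Proof.
have mono (k l : 'I_#|A|) : (k < l)%N -> (enum_val k < enum_val l)%N.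
  have x0 : 'I_n := enum_val k.
  move=> kl; rewrite !(enum_val_nth x0).
  apply: (sorted_ltn_nth (leT := fun i j : 'I_n => (i < j)%N)) => //.
  - by move=> ? ? ?; apply: ltn_trans.
  - exact: enum_ord_sorted.
  - by rewrite inE -cardE.
  - by rewrite inE -cardE.
case: (ltngtP i j) => [/mono //|/mono|/val_inj->]; last by rewrite ltnn.
by move/ltnW; rewrite leqNgt => /negbTE.
Qed.

Lemma enum_imset_enum_val n (A : {set 'I_n}) (B : {set 'I_#|A|}) :
  enum [set enum_val k | k in B] = [seq enum_val k | k <- enum B].
Proof.
apply: (irr_sorted_eq (leT := fun i j : 'I_n => (i < j)%N)).
- by move=> ? ? ?; apply: ltn_trans.
- by move=> ?; rewrite ltnn.
- exact: enum_ord_sorted.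
- rewrite sorted_map.
  rewrite (eq_sorted (e' := fun i j : 'I_#|A| => (i < j)%N)).
    exact: enum_ord_sorted.
  by move=> i j /=; rewrite enum_val_ord_mono.
move=> x; rewrite mem_enum; apply/imsetP/mapP=> -[k kB ->]; exists k => //.
  by rewrite mem_enum.
by rewrite mem_enum in kB.
Qed.

Lemma imset_enum_valT n (A : {set 'I_n}) :
  [set enum_val k | k in [set: 'I_#|A|]] = A.
Proof.
apply/setP=> x; apply/imsetP/idP => [[k _ ->]|Ax]; first exact: enum_valP.
by exists (enum_rank_in Ax x); rewrite ?inE ?enum_rankK_in.
Qed.

Section Words.
Variables SL SR : Type.

(** The subword on [A] as a tuple, indexed by the positions within [A]. *)
Definition restr_tuple n (w : n.-tuple (letter SL SR)) (A : {set 'I_n}) :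
    #|A|.-tuple (letter SL SR) :=
  [tuple tnth w (enum_val k) | k < #|A|].

Lemma restr_restr_tuple n (w : n.-tuple (letter SL SR)) (A : {set 'I_n})
    (B : {set 'I_#|A|}) :
  restr (restr_tuple w A) B = restr w [set enum_val k | k in B].
Proof.
rewrite /restr enum_imset_enum_val -map_comp.
by apply: eq_map => k; rewrite /= tnth_mktuple.
Qed.

Lemma restrT n (w : n.-tuple (letter SL SR)) : restr w [set: 'I_n] = w.
Proof.
rewrite /restr -[RHS]map_tnth_enum; congr map.
by rewrite /enum_mem; apply: eq_filter => x; rewrite !inE.
Qed.

Lemma restr_tupleE n (w : n.-tuple (letter SL SR)) (A : {set 'I_n}) :
  restr w A = restr_tuple w A.
Proof. by rewrite -[RHS]restrT restr_restr_tuple imset_enum_valT. Qed.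

Lemma eq_restr n (w w' : n.-tuple (letter SL SR)) (A : {set 'I_n}) :
  {in A, tnth w =1 tnth w'} -> restr w A = restr w' A.
Proof. by move=> eq_ww'; apply/eq_in_map => i; rewrite mem_enum => /eq_ww'. Qed.

Lemma necklace_lt_restr n (w : n.-tuple (letter SL SR)) (A : {set 'I_n})
    (i j : 'I_#|A|) :
  necklace_lt (word_type (restr_tuple w A)) i j =
  necklace_lt (word_type w) (enum_val i) (enum_val j).
Proof. by rewrite /necklace_lt !tnth_map !tnth_ord_tuple !enum_val_ord_mono. Qed.

(** * Translucidation *)

Lemma tnth_translucidation n (w : n.-tuple (letter SL SR)) (Z : {set 'I_n}) i :
  tnth (translucidation w Z) i =
  if i \in Z then Placeholder (letter_type (tnth w i)).1 else tnth w i.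
Proof. by rewrite tnth_mktuple. Qed.

Lemma translucidation_trans n (w : n.-tuple (letter SL SR)) (Z I : {set 'I_n}) :
  Z \subset I -> translucidation (translucidation w Z) I = translucidation w I.
Proof.
move=> /subsetP sZI; apply: eq_from_tnth => i; rewrite !tnth_translucidation.
case: ifP => [_|/negbT nIi]; first by case: ifP.
by rewrite (negbTE (contra (@sZI i) nIi)).
Qed.

Lemma translucidation_zeros n (w : n.-tuple (letter SL SR)) :
  translucidation w (zeros (word_type w)) = w.
Proof.
apply: eq_from_tnth => i; rewrite tnth_translucidation inE tnth_map.
by case: (tnth w i).
Qed.

Lemma ones_translucidation n (w : n.-tuple (letter SL SR)) (Z : {set 'I_n}) :
  zeros (word_type w) \subset Z -> ones (word_type (translucidation w Z)) = ~: Z.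
Proof.
move=> /subsetP sZ; apply/setP=> i; rewrite !inE tnth_map tnth_translucidation.
case: ifP => [//|/negbT nZi]; apply: contraR nZi => ni0.
by apply: sZ; rewrite inE tnth_map.
Qed.

Lemma zerosE n (t : n.-tuple (side * bool)) : zeros t = ~: ones t.
Proof. by apply/setP=> i; rewrite !inE. Qed.

Lemma necklace_lt_translucidation n (w : n.-tuple (letter SL SR)) (Z : {set 'I_n}) :
  necklace_lt (word_type (translucidation w Z)) =2 necklace_lt (word_type w).
Proof.
have side_tr i : (tnth (word_type (translucidation w Z)) i).1 =
                 (tnth (word_type w) i).1.
  by rewrite !tnth_map tnth_ord_tuple; case: ifP.
by move=> i j; rewrite /necklace_lt !side_tr.
Qed.

End Words.

(** * Ordered sequences of blocks *)

(** The rule that a block [V] obeys when it comes after [U]. *)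
Definition allowed_after (T : finType) (lt : rel T) (U V : {set T}) : bool :=
  [disjoint U & V] && never_inside lt U V.

Lemma allowed_afterUl (T : finType) (lt : rel T) (U U' V : {set T}) :
  allowed_after lt (U :|: U') V =
  allowed_after lt U V && allowed_after lt U' V.
Proof.
have disjU : [disjoint U :|: U' & V] = [disjoint U & V] && [disjoint U' & V].
  by rewrite -!setI_eq0 setIUl setU_eq0.
by rewrite /allowed_after never_insideUl disjU andbACA.
Qed.

(** [s] lists, in the order of their labels, the blocks of an ordered partition
    of the complement of [Z], which becomes monotone once [Z] is added as the
    minimum block. *)
Definition monotone_seq (T : finType) (lt : rel T) (Z : {set T})
    (s : seq {set T}) : bool :=
  [&& all (fun V => V != set0) s, pairwise (allowed_after lt) (Z :: s)
    & Z :|: \bigcup_(V <- s) V == [set: T]].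

(** The first block of a monotone sequence can be absorbed by the minimum
    block. *)
Lemma monotone_seq_cons (T : finType) (lt : rel T) (Z V : {set T}) s :
  monotone_seq lt Z (V :: s) =
  [&& V != set0, allowed_after lt Z V & monotone_seq lt (Z :|: V) s].
Proof.
rewrite /monotone_seq /= big_cons setUA.
have -> : all (allowed_after lt (Z :|: V)) s =
          all (allowed_after lt Z) s && all (allowed_after lt V) s.
  by rewrite -all_predI; apply: eq_all => U; rewrite /= allowed_afterUl.
by do ![case: (_ != _) | case: (allowed_after _ _ _) | case: (all _ _)].
Qed.

Lemma big_tuple_cons (R : nmodType) (T : finType) k (P : pred (seq T))
    (F : seq T -> R) :
  \sum_(s : k.+1.-tuple T | P s) F s =
  \sum_(x : T) \sum_(s : k.-tuple T | P (x :: s)) F (x :: s).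
Proof.
rewrite pair_big_dep /=.
rewrite (reindex (fun p : T * k.-tuple T => [tuple of p.1 :: p.2])) //=.
exists (fun s => (thead s, [tuple of behead s])) => [[x s] _|s _] /=.
  by congr pair; apply: val_inj.
by rewrite [RHS]tuple_eta.
Qed.

(** * Convolution powers *)

Section Convolution.
Variables (R : realType) (SL SR : Type).
Implicit Types (f g m : linear_form R SL SR) (n k : nat).

(** The convolution of a tuple, without the change of index type hidden in
    [in_tuple]. *)
Lemma conv_tuple f g n (w : n.-tuple (letter SL SR)) :
  conv f g w =
  \sum_(I : {set 'I_n} | zeros (word_type w) \subset I)
     f (restr w I) * g (translucidation w I).
Proof.
rewrite /conv; case: w => s sz; move: (sz); rewrite -(eqP sz) => sz' /=.
by rewrite (_ : in_tuple s = Tuple sz') //; apply: val_inj.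
Qed.

Lemma counit_tuple n (w : n.-tuple (letter SL SR)) :
  counit R w = (ones (word_type w) == set0)%:R.
Proof.
rewrite /counit; suff -> : all (fun l => ~~ (letter_type l).2) w =
  (ones (word_type w) == set0) by case: eqP.
apply/all_tnthP/eqP => [w0|w0 i].
  by apply/setP=> i; rewrite !inE tnth_map; apply/negbTE/w0.
by move/setP/(_ i): w0; rewrite !inE tnth_map => ->.
Qed.

Lemma counit_translucidation n (w : n.-tuple (letter SL SR)) (Z : {set 'I_n}) :
  zeros (word_type w) \subset Z ->
  counit R (translucidation w Z) = (Z == [set: 'I_n])%:R.
Proof.
move=> sZ; rewrite counit_tuple ones_translucidation //.
by rewrite -(inj_eq (@setC_inj _)) setCK setC0.
Qed.

Lemma conv_counitr f n (w : n.-tuple (letter SL SR)) :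
  conv f (@counit R SL SR) w = f w.
Proof.
rewrite conv_tuple (bigD1 [set: 'I_n]) ?subsetT //= big1 ?addr0.
  by rewrite counit_translucidation ?subsetT // eqxx mulr1 restrT.
move=> I /andP[sI /negbTE nIT].
by rewrite counit_translucidation // nIT mulr0.
Qed.

(** Powers are iterated from the exponent 1; that the counit is a right unit on
    words lets the exponent 0 serve as the base of the recursion. *)
Lemma conv_powS m k n (w : n.-tuple (letter SL SR)) :
  conv_pow m k.+1 w = conv m (conv_pow m k) w.
Proof. by case: k => //; rewrite [RHS]conv_counitr. Qed.

(** The single interval condition says that the nonzero terms of [conv m g] at a
    translucidation come from the nonempty sets [I :\: Z] in which no element of
    [Z] is nested. *)
Lemma in_mI_restr m (hm : in_mI m) n (w : n.-tuple (letter SL SR))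
    (Z I : {set 'I_n}) :
  zeros (word_type w) \subset Z -> Z \subset I ->
  m (restr (translucidation w Z) I) =
  if (I :\: Z != set0) && never_inside (necklace_lt (word_type w)) Z (I :\: Z)
  then m (restr w (I :\: Z)) else 0.
Proof.
move=> sZ /subsetP sZI; set u := translucidation w Z.
have lt_u (i j : 'I_#|I|) : necklace_lt (word_type (restr_tuple u I)) i j =
    necklace_lt (word_type w) (enum_val i) (enum_val j).
  by rewrite necklace_lt_restr necklace_lt_translucidation.
have ones_u (k : 'I_#|I|) :
    (k \in ones (word_type (restr_tuple u I))) = (enum_val k \notin Z).
  move/setP/(_ (enum_val k)): (ones_translucidation sZ).
  by rewrite !inE !tnth_map !tnth_ord_tuple.
have im_ones : [set enum_val k | k in ones (word_type (restr_tuple u I))] = I :\: Z.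
  apply/setP=> x; rewrite inE; apply/imsetP/andP=> [[k]|[nZx Ix]].
    by rewrite ones_u => nZk ->; split=> //; apply: enum_valP.
  exists (enum_rank_in Ix x); last by rewrite enum_rankK_in.
  by rewrite ones_u enum_rankK_in.
(* the value at a subword is governed by its own necklace order, which is the
   one of [w] read through [enum_val] *)
have {hm} [m0 m1] := hm _ (restr_tuple u I).
rewrite restr_tupleE; case: ifP => [|/negbT] cond.
  rewrite m1; first last.
    apply/eqP; rewrite card_necklace_int necklace_interval_ones.
    case/andP: cond => nz /never_insideP out; apply/andP; split.
      by apply: contraNneq nz => u0; rewrite -im_ones u0 imset0.
    apply/never_insideP=> a b c; rewrite !ones_u => Za Zc.
    rewrite zerosE in_setC ones_u negbK => Zb.
    by rewrite !lt_u; apply: out => //; rewrite inE enum_valP ?Za ?Zc.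
  rewrite restr_restr_tuple im_ones; congr m; apply: eq_restr => i.
  by rewrite inE tnth_translucidation => /andP[/negbTE->].
apply: m0; apply/eqP; apply: contra cond.
rewrite card_necklace_int necklace_interval_ones => /andP[nz /never_insideP out].
apply/andP; split; first by rewrite -im_ones imset_eq0.
apply/never_insideP=> a b c; rewrite -im_ones => /imsetP[a' a'1 ->].
case/imsetP=> c' c'1 -> Zb; have Ib := sZI _ Zb.
rewrite -(enum_rankK_in Ib Ib) -!lt_u; apply: out => //.
by rewrite zerosE in_setC ones_u enum_rankK_in // negbK.
Qed.

(** The powers of [m] are evaluated at all the translucidations of [w] at once,
    because each convolution enlarges the set of zeros by the block that it
    removes. *)
Lemma conv_pow_translucidation m (hm : in_mI m) n
    (w : n.-tuple (letter SL SR)) (Z : {set 'I_n}) k :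
  zeros (word_type w) \subset Z ->
  conv_pow m k (translucidation w Z) =
  \sum_(s : k.-tuple {set 'I_n} |
          monotone_seq (necklace_lt (word_type w)) Z s)
     \prod_(V <- s) m (restr w V).
Proof.
elim: k Z => [|k IHk] Z sZ.
  rewrite [LHS]counit_translucidation // big_mkcond (big_pred1 [tuple]) /=.
    by rewrite /monotone_seq /= !big_nil setU0; case: eqP.
  by move=> s; rewrite /= [s]tuple0; apply/esym/eqP.
rewrite (big_tuple_cons _ _ (fun s => \prod_(V <- s) m (restr w V))).
rewrite conv_powS conv_tuple zerosE ones_translucidation // setCK.
(* the first set of the chain is the union of [Z] and of the first block *)
rewrite (reindex_onto (fun V => Z :|: V) (fun I => I :\: Z)) /=; last first.
  move=> I /subsetP ZI; apply/setP=> x; rewrite !inE.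
  by case: (boolP (x \in Z)) => [/ZI->|].
rewrite big_mkcond; apply: eq_bigr => V _; rewrite subsetUl /=.
under [RHS]eq_bigl do rewrite monotone_seq_cons.
have -> : ((Z :|: V) :\: Z == V) = [disjoint Z & V].
  rewrite setDUl setDv set0U setDE disjoint_sym disjoints_subset.
  exact/eqP/setIidPl.
rewrite (_ : conv_pow m k _ = conv_pow m k (translucidation w (Z :|: V))); last first.
  by rewrite -(translucidation_trans w (subsetUl Z V)).
rewrite /allowed_after in_mI_restr ?subsetUl // IHk; last first.
  exact: subset_trans sZ (subsetUl _ _).
case: (boolP [disjoint Z & V]) => [disjZV|_]; last first.
  by rewrite big_pred0 // => s; rewrite andbF.
have -> : (Z :|: V) :\: Z = V.
  rewrite setDUl setDv set0U setDE; apply/setIidPl.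
  by rewrite -disjoints_subset disjoint_sym.
case: (V != set0) => /=; last by rewrite mul0r big_pred0.
case: (never_inside _ Z V) => /=; last by rewrite mul0r big_pred0.
by rewrite mulr_sumr; apply: eq_bigr => s _; rewrite big_cons.
Qed.

End Convolution.

(** * Ordered sequences of blocks as monotone bipartitions *)

Lemma monotone_seq_uniq (T : finType) (lt : rel T) (Z : {set T}) s :
  monotone_seq lt Z s -> uniq s.
Proof.
case/and3P=> nz /= /andP[_ s_after] _; rewrite uniq_pairwise.
apply: (sub_in_pairwise (P := [pred V | V != set0])) nz s_after => U V /= nzU _.
case/andP=> disjUV _; apply: contraNneq nzU => eqUV.
by rewrite -setI_eq0 -eqUV setIid in disjUV.
Qed.

Section Labelling.
Variable n : nat.
Implicit Types (p : labelled_blocks n) (V Z : {set 'I_n}) (s : seq {set 'I_n}).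

Lemma index_undup_lt s (V : {V : {set 'I_n} | V \in [set U in s]}) :
  (index (val V) (undup s) < #|[set U in s]|)%N.
Proof.
have -> : #|[set U in s]| = size (undup s).
  rewrite -(card_uniqP (undup_uniq s)) cardsE.
  by apply: eq_card => U; rewrite mem_undup.
by rewrite index_mem mem_undup; have := valP V; rewrite inE.
Qed.

(** The blocks of [s], each labelled by its position. Repetitions are discarded,
    so that this makes sense for every sequence. *)
Definition labelling s : labelled_blocks n :=
  existT (fun P : {set {set 'I_n}} =>
            {ffun {V : {set 'I_n} | V \in P} -> 'I_#|P|})
         [set U in s]
         [ffun V => Ordinal (index_undup_lt V)].

Lemma extended_label_labelling s V :
  uniq s ->
  extended_label (labelling s) V = if V \in s then (index V s).+1 else 0%N.
Proof.
move=> uniq_s; rewrite /extended_label; case: insubP => [V' Vs <-|].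
  by rewrite /= ffunE /= undup_id //; have := valP V'; rewrite inE => ->.
by rewrite inE => /negbTE->.
Qed.

(** The extended labels determine the labelling, which avoids comparing functions
    whose types depend on the partition. *)
Lemma eq_labelled_blocks p p' :
  tag p = tag p' -> extended_label p =1 extended_label p' -> p = p'.
Proof.
case: p p' => [P l] [P' l'] /= eqP'; case: _ / eqP' l' => l' eq_l.
congr existT; apply/ffunP=> V; apply: val_inj; apply: succn_inj.
by have := eq_l (val V); rewrite /extended_label valK.
Qed.

Lemma labelling_inj s s' :
  uniq s -> uniq s' -> labelling s = labelling s' -> s = s'.
Proof.
move=> us us' eq_ss'.
have mem_ss' V : (V \in s) = (V \in s').
  by have /setP/(_ V) := congr1 (@tag _ _) eq_ss'; rewrite !inE.
have index_ss' V : V \in s -> index V s = index V s'.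
  move=> Vs; have := congr1 (fun p => extended_label p V) eq_ss'.
  by rewrite !extended_label_labelling // -mem_ss' Vs => -[].
have size_ss' : size s = size s' by apply/perm_size/uniq_perm.
apply: (@eq_from_nth _ set0) => // i lt_i.
have si : nth set0 s i \in s by rewrite mem_nth.
by have := index_ss' _ si; rewrite index_uniq // => {2}->; rewrite nth_index // -mem_ss'.
Qed.

(** [labelling] reaches every partition with injective labels: listing the blocks
    by increasing label inverts it. *)
Lemma labelling_surj p :
  injective (tagged p) ->
  exists s, [/\ uniq s, size s = #|tag p| & labelling s = p].
Proof.
case: p => [P l] /= inj_l; pose p : labelled_blocks n := Tagged _ l.
pose s := sort (relpre (extended_label p) leq) (enum P).
have label_mem V : V \in P -> exists2 k : 'I_#|P|, extended_label p V = k.+1 &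
    forall V', V' \in P -> extended_label p V' = k.+1 -> V = V'.
  move=> PV; exists (l (exist _ V PV)).
    by rewrite /extended_label (insubT (fun U => U \in P) PV).
  move=> V' PV'; rewrite /extended_label (insubT (fun U => U \in P) PV') /=.
  by case=> /val_inj/inj_l[].
have mem_s V : (V \in s) = (V \in P) by rewrite mem_sort mem_enum.
have uniq_s : uniq s by rewrite sort_uniq enum_uniq.
have size_s : size s = #|P| by rewrite size_sort -cardE.
have labels_s : map (extended_label p) s = iota 1 #|P|.
  have sub V : V \in s -> extended_label p V \in iota 1 #|P|.
    rewrite mem_s => /label_mem[k -> _].
    by rewrite mem_iota add1n !ltnS ltn_ord.
  have uniq_l : uniq (map (extended_label p) s).
    rewrite map_inj_in_uniq // => V V'; rewrite !mem_s => PV PV' eqVV'.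
    have [k Vk eqV] := label_mem V PV; apply: eqV => //.
    by rewrite -eqVV'.
  apply: (sorted_eq leq_trans anti_leq).
  - by rewrite sorted_map sort_sorted // => V V'; apply: leq_total.
  - exact: iota_sorted.
  apply: uniq_perm (iota_uniq _ _) _ => //.
  have sub_iota : {subset map (extended_label p) s <= iota 1 #|P|}.
    by move=> _ /mapP[V sV ->]; apply: sub.
  have [|_ eq_mem] // := uniq_min_size uniq_l sub_iota.
  by rewrite size_iota size_map size_s.
exists s; split=> //; apply: eq_labelled_blocks => [|V] /=.
  by apply/setP=> V; rewrite inE mem_s.
rewrite extended_label_labelling //; case: ifP => [sV|/negbT]; last first.
  by rewrite mem_s => nPV; rewrite /extended_label insubN.
rewrite -[in RHS](nth_index set0 sV) -[in RHS](nth_map _ 0%N) ?index_mem //.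
by rewrite labels_s nth_iota // -size_s index_mem.
Qed.

Lemma card_tag_labelling s : uniq s -> #|tag (labelling s)| = size s.
Proof. by move=> uniq_s; rewrite /= cardsE; apply/card_uniqP. Qed.

Lemma labelling_bij s : uniq s ->
  injectiveb (tagged (labelling s)) /\
  [forall k, k \in codom (tagged (labelling s))].
Proof.
move=> uniq_s; have inj_l : injective (tagged (labelling s)).
  move=> V V' /= eqVV'; apply: val_inj.
  have sV (U : {U : {set 'I_n} | U \in [set U in s]}) : val U \in s.
    by have := valP U; rewrite inE.
  rewrite -(nth_index set0 (sV V)) -(nth_index set0 (sV V')).
  by move: eqVV'; rewrite !ffunE => -[]; rewrite !undup_id // => ->.
split; first exact/injectiveP.
by apply/forallP=> k; apply: inj_card_onto => //; rewrite card_ord card_sig.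
Qed.

(** A monotone sequence is a monotone ordered partition: never being inside a
    later block is the monotonicity of the labels, and this already excludes
    crossings, since crossing blocks would have equal labels. *)
Lemma labelling_monotone_bipartition (t : n.-tuple (side * bool)) s : uniq s ->
  (labelling s \in monotone_bipartitions t) =
  monotone_seq (necklace_lt t) (zeros t) s.
Proof.
move=> uniq_s; have [inj_l onto_l] := labelling_bij uniq_s.
rewrite inE inj_l onto_l /= {inj_l onto_l}.
have label_s V := extended_label_labelling V uniq_s.
have mem_ext V : (V \in extended_blocks t (labelling s)) =
    (V == zeros t) && (zeros t != set0) || (V \in s).
  rewrite /extended_blocks /=; case: eqP => [->|_]; first by rewrite andbF inE.
  by rewrite andbT !inE.
have coverE : cover [set V in s] = \bigcup_(V <- s) V.
  by rewrite big_uniq //; apply: eq_bigl => V; rewrite inE.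
apply/idP/idP.
  case/and3P=> /and3P[/eqP cover_s triv_s set0_s] _ /forall_inP mono.
  have {}mono V V' a b c : V \in s -> V' \in extended_blocks t (labelling s) ->
      a \in V -> b \in V' -> c \in V -> necklace_lt t a b -> necklace_lt t b c ->
      (extended_label (labelling s) V <= extended_label (labelling s) V')%N.
    move=> sV eV' Va Vb Vc ab bc; have eV : V \in extended_blocks t (labelling s).
      by rewrite mem_ext sV orbT.
    have /forall_inP/(_ _ eV')/forall_inP/(_ _ Va) := mono _ eV.
    by move=> /forall_inP/(_ _ Vb)/forall_inP/(_ _ Vc); rewrite ab bc.
  have s_ones V : V \in s -> V \subset ones t.
    by move=> sV; rewrite -cover_s; apply: bigcup_max (subxx V); rewrite inE.
  have nz_s V : V \in s -> V != set0.
    by apply: contraTneq => ->; move: set0_s; rewrite inE.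
  have disjZ V : V \in s -> [disjoint zeros t & V].
    move=> /s_ones sV; rewrite zerosE disjoint_sym disjoints_subset setCK.
    exact: sV.
  have nsZ : zeros t \notin s.
    apply/negP=> sZ; have := disjZ _ sZ; rewrite -setI_eq0 setIid.
    exact/negP/nz_s.
  apply/and3P; split; first exact/allP.
    rewrite /= andbC; apply/andP; split.
      apply/(pairwiseP set0) => i j; rewrite !inE => lt_i lt_j lt_ij.
      apply/andP; split.
        apply: (trivIsetP triv_s); rewrite ?inE ?mem_nth //.
        by rewrite nth_uniq // (ltn_eqF lt_ij).
      apply/never_insideP=> a b c Va Vc Vb ab bc.
      have := mono _ _ a b c (mem_nth set0 lt_j) _ Va Vb Vc ab bc.
      rewrite mem_ext mem_nth // orbT => /(_ isT).
      by rewrite !label_s !mem_nth // !index_uniq // ltnS leqNgt lt_ij.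
    apply/allP=> V sV; rewrite /allowed_after disjZ //.
    apply/never_insideP=> a b c Va Vc Zb ab bc.
    have nzZ : zeros t != set0 by apply/set0Pn; exists b.
    have := mono V (zeros t) a b c sV _ Va Zb Vc ab bc.
    by rewrite mem_ext eqxx nzZ => /(_ isT); rewrite !label_s sV (negbTE nsZ).
  by rewrite -coverE cover_s zerosE setUC setUCr.
case/and3P=> /allP nz_s /= /andP[/allP after_Z after_s] /eqP cover_s.
have disjZ V : V \in s -> [disjoint zeros t & V] by case/after_Z/andP.
have s_ones V : V \in s -> V \subset ones t.
  by move/disjZ; rewrite disjoint_sym disjoints_subset zerosE setCK.
have nsZ : zeros t \notin s.
  apply/negP=> sZ; have := disjZ _ sZ; rewrite -setI_eq0 setIid.
  exact/negP/nz_s.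
have after V V' : V \in s -> V' \in s -> (index V s < index V' s)%N ->
    allowed_after (necklace_lt t) V V'.
  move=> sV sV' lt_VV'; rewrite -(nth_index set0 sV) -(nth_index set0 sV').
  by apply: (pairwiseP set0 after_s); rewrite ?inE ?index_mem.
have mono V V' a b c : V \in extended_blocks t (labelling s) ->
    V' \in extended_blocks t (labelling s) ->
    a \in V -> b \in V' -> c \in V -> necklace_lt t a b -> necklace_lt t b c ->
    (extended_label (labelling s) V <= extended_label (labelling s) V')%N.
  rewrite !mem_ext => /orP[/andP[/eqP-> _]|sV]; first by rewrite label_s (negbTE nsZ).
  case/orP=> [/andP[/eqP-> _]|sV'] Va Vb Vc ab bc.
    by case/andP: (after_Z _ sV) => _ /never_insideP/(_ a b c Va Vc Vb ab bc).
  rewrite !label_s sV sV' ltnS leqNgt; apply/negP=> /(after _ _ sV' sV)/andP[_].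
  by move/never_insideP/(_ a b c Va Vc Vb ab bc).
have label_inj V V' : V \in extended_blocks t (labelling s) ->
    V' \in extended_blocks t (labelling s) ->
    extended_label (labelling s) V = extended_label (labelling s) V' -> V = V'.
  rewrite !mem_ext !label_s => /orP[/andP[/eqP-> _]|sV] /orP[/andP[/eqP-> _]|sV'] //.
  - by rewrite sV' (negbTE nsZ).
  - by rewrite sV (negbTE nsZ).
  rewrite sV sV' => -[eq_index].
  by rewrite -(nth_index set0 sV) -(nth_index set0 sV') eq_index.
rewrite /monotone_partition; apply/and3P; split; last first.
- apply/forall_inP=> V eV; apply/forall_inP=> V' eV'; apply/forall_inP=> a Va.
  apply/forall_inP=> b Vb; apply/forall_inP=> c Vc; apply/implyP=> /andP[ab bc].
  exact: mono eV eV' Va Vb Vc ab bc.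
- apply/forall_inP=> V eV; apply/forall_inP=> V' eV'; apply/implyP=> nVV'.
  apply/forall_inP=> a Va; apply/forall_inP=> b Vb; apply/forall_inP=> c Vc.
  apply/forall_inP=> d Vd; apply/negP=> /and3P[ab bc cd].
  case/eqP: nVV'; apply: label_inj => //; apply/anti_leq.
  by rewrite (mono V V' a b c) // (mono V' V b c d).
apply/and3P; split; last by rewrite inE; apply/negP=> /nz_s/eqP.
  rewrite eqEsubset; apply/andP; split.
    by apply/bigcupsP=> V; rewrite inE; apply: s_ones.
  apply/subsetP=> x; rewrite coverE; move/setP/(_ x): cover_s.
  by rewrite !inE => /orP[/negbTE->|].
apply/trivIsetP=> V V'; rewrite !inE => sV sV' nVV'.
case: (ltngtP (index V s) (index V' s)) => [lt_VV'|lt_VV'|eq_index].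
- by case/andP: (after _ _ sV sV' lt_VV').
- by rewrite disjoint_sym; case/andP: (after _ _ sV' sV lt_VV').
by case/eqP: nVV'; rewrite -(nth_index set0 sV) -(nth_index set0 sV') eq_index.
Qed.

Lemma sum_monotone_seq (R : comNzRingType) (F : {set 'I_n} -> R)
    (t : n.-tuple (side * bool)) k :
  \sum_(s : k.-tuple {set 'I_n} | monotone_seq (necklace_lt t) (zeros t) s)
     \prod_(V <- s) F V =
  \sum_(p in monotone_bipartitions t | #|tag p| == k) \prod_(V in tag p) F V.
Proof.
pose A := [set s : k.-tuple {set 'I_n} | monotone_seq (necklace_lt t) (zeros t) s].
have uniqA (s : k.-tuple {set 'I_n}) : s \in A -> uniq s.
  by rewrite inE; apply: monotone_seq_uniq.
have imA : [set labelling (tval s) | s in A] =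
           [set p in monotone_bipartitions t | #|tag p| == k].
  apply/setP=> p; rewrite inE; apply/imsetP/andP => [[s As ->]|[MBp /eqP size_p]].
    have uniq_s := uniqA _ As; rewrite labelling_monotone_bipartition //.
    by move: As; rewrite inE card_tag_labelling // size_tuple eqxx.
  have /and4P[_ /injectiveP/labelling_surj[s [uniq_s size_s eq_p]] _ _] :
    [&& finset.partition (tag p) (ones t), injectiveb (tagged p),
        [forall k, k \in codom (tagged p)]
      & monotone_partition (necklace_lt t) (extended_blocks t p)
          (extended_label p)] by rewrite inE in MBp.
  have size_sk : size s == k by rewrite size_s size_p.
  exists (Tuple size_sk) => //.
  by rewrite inE /= -labelling_monotone_bipartition // eq_p.
rewrite -(eq_bigl _ _ (in_set _)) -/A.
rewrite [RHS](eq_bigl (fun p => p \in [set labelling (tval s) | s in A])); last first.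
  by move=> p /=; rewrite imA [in RHS]inE.
rewrite big_imset /=; last first.
  move=> s s' As As' /labelling_inj eq_ss'.
  by apply/val_inj/eq_ss'; apply: uniqA.
apply: eq_bigr => s As; rewrite (big_uniq _ (uniqA _ As)) /=.
by apply: eq_bigl => V; rewrite inE.
Qed.

End Labelling.
End ConvolutionExponential.

(** * The convolution exponential *)

Theorem theorem5p10 (R : realType) (SL SR : finType)
    (m : linear_form R SL SR) (hm : in_mI m)
    (n : nat) (t : n.-tuple (side * bool)) (w : n.-tuple (letter SL SR))
    (hw : w \in words t) :
  conv_exp m w =
  \sum_(p in monotone_bipartitions t)
     (#|tag p|`!%:R)^-1 * \prod_(V in tag p) m (restr w V).
Proof.
have <- : word_type w = t.
  apply: eq_from_tnth => i; rewrite tnth_map.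
  by apply/eqP; move/forallP: hw => /(_ i).
set MB := monotone_bipartitions _.
have pow_w k : conv_pow m k w =
    \sum_(p in MB | #|tag p| == k) \prod_(V in tag p) m (restr w V).
  rewrite -{1}(translucidation_zeros w) conv_pow_translucidation //.
  exact: sum_monotone_seq.
(* a crude bound on the number of blocks truncates the series *)
pose N := #|{set 'I_n}|.
rewrite /conv_exp (fsbigop.fsbigE (index_iota 1 N.+1)) ?iota_uniq //; first last.
- move=> k /= k_gt0; rewrite mem_index_iota ltnS negb_and -ltnNge ltnS.
  rewrite (leqNgt k 0) k_gt0 orFb -ltnNge => lt_Nk.
  rewrite pow_w big_pred0 ?GRing.mulr0 // => p.
  by rewrite (ltn_eqF (leq_ltn_trans (max_card _) lt_Nk)) andbF.
- by move=> k /=; rewrite mem_index_iota => /andP[].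
rewrite big_seq_cond [X in _ + X](eq_bigl (fun k => k \in index_iota 1 N.+1)).
  rewrite -big_seq.
  have -> : counit R w = (0`!%:R)^-1 * conv_pow m 0 w.
    by rewrite GRing.invr1 GRing.mul1r.
  transitivity (\sum_(0 <= k < N.+1) (k`!%:R)^-1 * conv_pow m k w).
    by rewrite [RHS]big_ltn.
  rewrite big_mkord.
  rewrite (partition_big
    (fun p : labelled_blocks n => inord #|tag p| : 'I_N.+1) xpredT) //=.
  apply: eq_bigr => k _; rewrite pow_w GRing.mulr_sumr.
  apply: eq_big => [p|p /andP[_ /eqP->] //].
  by rewrite -val_eqE /= inordK // ltnS max_card.
move=> k; apply/andP/idP => [[]//|k_iota]; split=> //.
by apply: classical_sets.mem_set; move: k_iota; rewrite mem_index_iota => /andP[].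
Qed.
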